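(* Let $n\in\mathbb{N}$, let $H\subseteq\mathbb{R}$ with $|H|\ge n+2$, let $\omega=(\omega_1,\dots,\omega_n):H\to\mathbb{R}^n$ be an $n$-dimensional positive Chebyshev system over $H$, and let $\omega_{n+1}:H\to\mathbb{R}$ be such that $\omega^*=(\omega_1,\dots,\omega_n,\omega_{n+1})$ is an $(n+1)$-dimensional positive Chebyshev system over $H$. Let $m\in\mathbb{N}$ with $n\le m\le |H|-1$ and let $x_0<\dots<x_m$ be elements of $H$. Then, for all integers $0\le i_0<\dots<i_n\le m$ and for every function $f:\{x_0,\dots,x_m\}\to\mathbb{R}$, $$\min_{0\le i\le m-n}\big[x_i,\dots,x_{i+n};f\big]_{\omega^*}\le\big[x_{i_0},\dots,x_{i_n};f\big]_{\omega^*}\le\max_{0\le i\le m-n}\big[x_i,\dots,x_{i+n};f\big]_{\omega^*}.$$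
   Context: $\mathbb{N}$ is the set of positive integers. For $H\subseteq\mathbb{R}$ and $k\in\mathbb{N}$, $\sigma_k(H):=\{(x_1,\dots,x_k)\in H^k\mid x_1<\dots<x_k\}$. For $\omega=(\omega_1,\dots,\omega_k):H\to\mathbb{R}^k$ and $(x_1,\dots,x_k)\in\sigma_k(H)$, $\Phi_\omega(x_1,\dots,x_k):=\det\big(\omega_i(x_j)\big)_{i,j=1}^k$. $\omega$ is a $k$-dimensional positive Chebyshev system over $H$ if $\Phi_\omega>0$ on $\sigma_k(H)$ (where $|H|\ge k$). For an $n$-dimensional $\omega$ and a real function $f$, $(\omega,f):=(\omega_1,\dots,\omega_n,f)$. The generalized $\omega^*$-divided difference of a real function $f$ (defined at the points involved) is $$[x_0,\dots,x_n;f]_{\omega^*}:=\frac{\Phi_{(\omega,f)}(x_0,\dots,x_n)}{\Phi_{\omega^*}(x_0,\dots,x_n)}\qquad\text{for } (x_0,\dots,x_n)\in\sigma_{n+1}(H).$$ If $H$ is infinite, the condition $m\le|H|-1$ is vacuous. *)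

(* Defs.v *)
From HB Require Import structures.
From mathcomp Require Import all_boot all_order all_algebra.
From mathcomp Require Import boolp classical_sets functions cardinality reals.

Set Implicit Arguments.
Unset Strict Implicit.
Unset Printing Implicit Defensive.

Import Order.TTheory GRing.Theory Num.Theory.
Local Open Scope classical_set_scope.
Local Open Scope card_scope.
Local Open Scope ring_scope.

(* Functions on a subset H of R are represented by total functions on R.     *)
(* All definitions below evaluate them at points of H only, so their values  *)
(* outside H are irrelevant. Indices are shifted to start at 0.              *)

Definition sigma (R : realType) (k : nat) (H : set R) : set ('I_k -> R) :=
  [set x | (forall j, H (x j)) /\ (forall i j : 'I_k, (i < j)%N -> x i < x j)].

Definition Phi (R : realType) (k : nat) (omega : 'I_k -> R -> R)
    (x : 'I_k -> R) : R :=
  \det (\matrix_(i < k, j < k) omega i (x j)).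

(* `I_k #<= H states that H has at least k elements; it holds for every k    *)
(* when H is infinite.                                                       *)
Definition positive_chebyshev (R : realType) (k : nat) (H : set R)
    (omega : 'I_k -> R -> R) : Prop :=
  `I_k #<= H /\ (forall x, sigma H x -> 0 < Phi omega x).

(* The system (omega_1, ..., omega_n, f).                                    *)
Definition adjoin (R : realType) (n : nat) (omega : 'I_n -> R -> R)
    (f : R -> R) : 'I_n.+1 -> R -> R :=
  fun i => if unlift ord_max i is Some j then omega j else f.

(* The divided difference of f with respect to omega* = (omega, w).          *)
Definition gdivdiff (R : realType) (n : nat) (omega : 'I_n -> R -> R)
    (w f : R -> R) (x : 'I_n.+1 -> R) : R :=
  Phi (adjoin omega f) x / Phi (adjoin omega w) x.

(* The points x_i, ..., x_(i+n). For i <= m - n and n <= m all the indices   *)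
(* are at most m, so that inord is not applied out of range.                 *)
Definition window (R : realType) (m n : nat) (x : 'I_m.+1 -> R) (i : nat) :
    'I_n.+1 -> R :=
  fun j => x (inord (i + j)).

(* The neutral element of the iteration is a member of the family, hence     *)
(* these are the minimum and the maximum of the family a.                    *)
Definition min_family (R : realType) (k : nat) (a : 'I_k.+1 -> R) : R :=
  \big[Num.min/a ord0]_(i < k.+1) a i.

Definition max_family (R : realType) (k : nat) (a : 'I_k.+1 -> R) : R :=
  \big[Num.max/a ord0]_(i < k.+1) a i.

(* Main.v *)
(* Subtracting c w from f, both bounds reduce to the following: if the
   determinants of (omega, g) are nonnegative on all windows of consecutive
   points, then they are nonnegative on all increasing (n+1)-tuples. For
   y_0 < ... < y_(n+1) and 0 < k < n+1 there is a three-term Pluecker relation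
     Phi_omega(y\{0,n+1}) D_k = Phi_omega(y\{k,n+1}) D_0
                                + Phi_omega(y\{0,k}) D_(n+1),
   where D_j is the determinant of (omega, g) on y\{j}. Filling a gap of a
   nonconsecutive tuple with a point y_k thus expresses its determinant with
   positive weights through two tuples of smaller spread. *)
Require Import Defs.
From HB Require Import structures.
From mathcomp Require Import all_boot all_order all_algebra.
From mathcomp Require Import boolp classical_sets functions cardinality reals.
From mathcomp Require Import zify ring.

Set Implicit Arguments.
Unset Strict Implicit.
Unset Printing Implicit Defensive.

Import Order.TTheory GRing.Theory Num.Theory.
Local Open Scope classical_set_scope.
Local Open Scope card_scope.
Local Open Scope ring_scope.

Lemma eq_Phi (R : realType) (k : nat) (omega : 'I_k -> R -> R)
    (x y : 'I_k -> R) : x =1 y -> Phi omega x = Phi omega y.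
Proof. by move=> xy; congr (\det _); apply/matrixP => i j; rewrite !mxE xy. Qed.

(** The adjoined function fills only the last row, and the determinant is linear in that row. *)
Lemma Phi_adjoin_lincomb (R : realType) (n : nat) (omega : 'I_n -> R -> R)
    (f g : R -> R) (a b : R) (x : 'I_n.+1 -> R) :
  Phi (adjoin omega (fun t => a * f t + b * g t)) x =
  a * Phi (adjoin omega f) x + b * Phi (adjoin omega g) x.
Proof.
apply: (determinant_multilinear (i0 := ord_max)).
- by apply/rowP => j; rewrite !mxE /adjoin unlift_none.
- by apply/matrixP => i j; rewrite !mxE /adjoin liftK.
- by apply/matrixP => i j; rewrite !mxE /adjoin liftK.
Qed.

(* Phi at the first k points of a sequence, and the deletion of a point from a
   sequence: this avoids casts between ordinal types. *)
Definition PhiN (R : realType) (k : nat) (omega : 'I_k -> R -> R)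
    (y : nat -> R) : R := Phi omega (fun j => y j).

Definition skip (R : realType) (y : nat -> R) (k j : nat) : R := y (bump k j).

Lemma eq_PhiN (R : realType) (k : nat) (omega : 'I_k -> R -> R)
    (y z : nat -> R) : (forall j, (j < k)%N -> y j = z j) ->
  PhiN omega y = PhiN omega z.
Proof. by move=> yz; apply: eq_Phi => j; apply: yz. Qed.

Lemma PhiN_skip_max (R : realType) (k : nat) (omega : 'I_k -> R -> R)
    (y : nat -> R) : PhiN omega (skip y k) = PhiN omega y.
Proof. by apply: eq_PhiN => j jk; rewrite /skip /bump leqNgt jk. Qed.

(* Laplace expansion of a determinant whose first row is a combination of the
   other ones. *)
Lemma PhiN_span_relation (R : realType) (n : nat) (omega : 'I_n -> R -> R)
    (c : 'I_n -> R) (y : nat -> R) :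
  \sum_(j < n.+1)
    (-1) ^+ j * (\sum_i c i * omega i (y j)) * PhiN omega (skip y j) = 0.
Proof.
transitivity (\sum_i \sum_(j < n.+1)
    (-1) ^+ j * (c i * omega i (y j)) * PhiN omega (skip y j)).
  rewrite [RHS]exchange_big; apply: eq_bigr => j _.
  by rewrite -mulr_suml -mulr_sumr.
rewrite big1 //= => i _.
(* Putting [omega i] on top of the whole system repeats one row, so the determinant vanishes; its
   expansion along the top row is the inner sum up to the factor [c i]. *)
pose M := \matrix_(a < n.+1, b < n.+1)
  omega (if unlift ord0 a is Some a' then a' else i) (y b).
have M0 : \det M = 0.
  apply: (determinant_alternate (i1 := ord0) (i2 := lift ord0 i)) => // j.
  by rewrite !mxE unlift_none liftK.
transitivity (c i * \det M); last by rewrite M0 mulr0.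
rewrite (expand_det_row _ ord0) mulr_sumr; apply: eq_bigr => j _.
rewrite !mxE unlift_none /cofactor add0n.
have -> : \det (row' ord0 (col' j M)) = PhiN omega (skip y j).
  by congr (\det _); apply/matrixP => a b; rewrite !mxE liftK.
by ring.
Qed.

(** The coefficients form row [q] of the inverse of the collocation matrix. *)
Lemma lincomb_interpolation (R : realType) (n : nat) (omega : 'I_n -> R -> R)
    (z : 'I_n -> R) (q : 'I_n) : Phi omega z != 0 ->
  exists c : 'I_n -> R, forall j, \sum_i c i * omega i (z j) = (j == q)%:R.
Proof.
move=> z0; pose A := \matrix_(i < n, j < n) omega i (z j).
have uA : A \in unitmx by rewrite unitmxE unitfE.
exists (fun i => (delta_mx 0 q *m invmx A) (0 : 'I_1) i) => j.
have := congr1 (fun M : 'rV_n => M 0 j) (mulmxKV uA (delta_mx 0 q)).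
rewrite !mxE eqxx => <-.
by apply: eq_bigr => i _; rewrite !mxE.
Qed.

Lemma sum_one (R : realType) (n : nat) (F : nat -> R) (k : nat) :
  (k < n)%N -> (forall j, (j < n)%N -> j != k -> F j = 0) ->
  \sum_(j < n) F j = F k.
Proof.
move=> kn F0; rewrite (bigD1 (Ordinal kn)) //= big1 ?addr0 // => i ik.
exact: F0.
Qed.

(** Take [r] in the span of [omega] with value 1 at [y q.+1] and 0 at the other points among [y 1],
    ..., [y n]. Three span relations for [r] then have few nonzero terms, and eliminating [r (y 0)]
    and [r (y n.+1)] from them gives the identity. *)
Lemma Phi_three_term (R : realType) (n : nat) (omega : 'I_n -> R -> R)
    (g : R -> R) (y : nat -> R) (q : nat) :
  (q < n)%N -> PhiN omega (skip y 0) != 0 ->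
  PhiN omega (skip y 0) * PhiN (adjoin omega g) (skip y q.+1) =
  PhiN omega (skip y q.+1) * PhiN (adjoin omega g) (skip y 0) +
  PhiN omega (skip (skip y 0) q) * PhiN (adjoin omega g) y.
Proof.
move=> qn P0.
have [c hc] := lincomb_interpolation (Ordinal qn) P0.
pose r t := \sum_i c i * omega i t.
have rE j : (j < n)%N -> r (y j.+1) = (j == q)%:R.
  by move=> jn; have := hc (Ordinal jn); rewrite /r /skip /bump /=.
(* A zero coefficient at [g] places [r] in the span of the enlarged system. *)
pose C := fun i => if unlift ord_max i is Some j then c j else 0.
have CE t : \sum_i C i * adjoin omega g i t = r t.
  rewrite big_ord_recr /= /C /adjoin unlift_none mul0r addr0.
  apply: eq_bigr => i _.
  have -> : widen_ord (leqnSn n) i = lift ord_max i.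
    by apply: val_inj; rewrite /= /bump leqNgt ltn_ord.
  by rewrite liftK.
have rq : r (y q.+1) = 1 by rewrite rE ?eqxx.
have r0 j : (j < n)%N -> j != q -> r (y j.+1) = 0.
  by move=> jn /negbTE jq; rewrite rE ?jq.
(* The points are [y 0], ..., [y n.+1] in [e1], [y 0], ..., [y n] in [e2], and [y 1], ..., [y n.+1]
   in [e3]. Only [y 0], [y q.+1] and [y n.+1] can contribute. *)
have e1 := PhiN_span_relation (adjoin omega g) C y.
have e2 := PhiN_span_relation omega c y.
have e3 := PhiN_span_relation omega c (skip y 0).
rewrite big_ord_recr big_ord_recl /= in e1.
rewrite big_ord_recl /= in e2.
rewrite big_ord_recr /= in e3.
rewrite (@sum_one _ n (fun j => (-1) ^+ j.+1 *
    (\sum_i C i * adjoin omega g i (y j.+1)) *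
    PhiN (adjoin omega g) (skip y j.+1)) q) // in e1; last first.
  by move=> j jn jq; rewrite CE r0 ?mulr0 ?mul0r.
rewrite (@sum_one _ n (fun j => (-1) ^+ j.+1 *
    r (y j.+1) * PhiN omega (skip y j.+1)) q) // in e2; last first.
  by move=> j jn jq; rewrite r0 ?mulr0 ?mul0r.
rewrite (@sum_one _ n (fun j => (-1) ^+ j *
    r (y j.+1) * PhiN omega (skip (skip y 0) j)) q) // in e3; last first.
  by move=> j jn jq; rewrite r0 ?mulr0 ?mul0r.
rewrite !CE rq PhiN_skip_max in e1.
rewrite -/(r _) rq in e2.
rewrite -/(r _) rq PhiN_skip_max in e3.
move: e1 e2 e3; rewrite [skip y 0 n]/skip [bump 0 n]/bump /= add1n.
set a := r (y 0); set b := r (y n.+1).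
set P := PhiN omega _; set D0 := PhiN _ (skip y 0); set D1 := PhiN _ y.
set Dk := PhiN _ (skip y q.+1); set A := PhiN _ (skip y _).
set B := PhiN _ (skip (skip _ _) _).
rewrite !exprS expr0.
have : ((-1) ^+ q * (-1) ^+ q : R) = 1 by rewrite -exprMn mulrNN mulr1 expr1n.
set e := (-1) ^+ q; set d := (-1) ^+ n => ee e1 e2 e3.
apply: subr0_eq.
(* With multipliers [- (e * P)], [e * D0] and [- (e * D1)] for [e1], [e2] and [e3], the terms in [a]
   and [b] cancel; the last summand corrects for [e * e], which equals 1. *)
transitivity
  (- (e * P) * (1 * a * D0 + -1 * e * 1 * Dk + -1 * d * b * D1)
   + e * D0 * (1 * a * P + -1 * e * 1 * A) - e * D1 * (e * 1 * B + d * b * P)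
   + (1 - e * e) * (P * Dk - (A * D0 + B * D1))); first by ring.
by rewrite e1 e2 e3 ee subrr !mulr0 mul0r !addr0 subrr.
Qed.

(** Strong induction on the spread [s n - s 0]: a tuple without gaps is a window, and any other
    tuple is reduced by filling one gap. *)
Lemma PhiN_ge0_of_windows (R : realType) (n m : nat) (omega : 'I_n -> R -> R)
    (g : R -> R) (x : nat -> R) :
  (forall t : nat -> nat, (forall i j, (i < j < n)%N -> (t i < t j)%N) ->
     (forall i, (i < n)%N -> (t i <= m)%N) ->
     0 < PhiN omega (fun j => x (t j))) ->
  (forall i, (i + n <= m)%N ->
     0 <= PhiN (adjoin omega g) (fun j => x (i + j)%N)) ->
  forall s : nat -> nat, (forall i j, (i < j <= n)%N -> (s i < s j)%N) ->
    (s n <= m)%N -> 0 <= PhiN (adjoin omega g) (fun j => x (s j)).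
Proof.
move=> pos win s; have [d] := ubnP (s n - s 0)%N.
elim: d s => // d IH s sd s_incr snm.
have s_le j : (j <= n)%N -> (s j <= s n)%N.
  by rewrite leq_eqVlt => /predU1P[->//|jn]; rewrite ltnW // s_incr ?jn /=.
have s_ge j : (j <= n)%N -> (s 0%N <= s j)%N.
  by case: j => // j jn; rewrite ltnW // s_incr.
have [/existsP[q gap]|/existsPn no_gap] :=
    boolP [exists q : 'I_n, ((s q).+1 < s q.+1)%N]; last first.
  have sE j : (j <= n)%N -> s j = (s 0 + j)%N.
    elim: j => [|j IHj] jn; first by rewrite addn0.
    have := no_gap (Ordinal jn); have := s_incr j j.+1.
    by rewrite /= ltnSn jn => /(_ isT); rewrite IHj ?(ltnW jn) //; lia.
  rewrite (_ : PhiN _ _ = PhiN (adjoin omega g) (fun j => x (s 0 + j)%N)).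
    by apply: win; rewrite -sE.
  by apply: eq_PhiN => j; rewrite ltnS => /sE ->.
have qn := ltn_ord q.
(* [t] is [s] with the index [(s q).+1] inserted at position [q.+1], so deleting that position gives
   back [s]. *)
pose t j := if (j <= q)%N then s j else if j == q.+1 then (s q).+1 else s j.-1.
have t_incr i j : (i < j <= n.+1)%N -> (t i < t j)%N.
  move=> /andP[ij jn]; rewrite /t.
  have si a b : (a < b)%N -> (b <= n)%N -> (s a < s b)%N.
    by move=> ab bn; apply: s_incr; rewrite ab.
  case: (leqP i q) => iq; case: (leqP j q) => jq; first by apply: si => //; lia.
  - case: eqVneq => [_|jq1].
      have [->//|/eqP iq'] := eqVneq i (q : nat).
      by rewrite ltnS ltnW // si; lia.
    by apply: si; lia.
  - lia.
  - case: eqVneq => iq1; case: eqVneq => jq1; try lia.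
      have [jq2|jq2] := eqVneq j q.+2; first by rewrite jq2 /=.
      by apply: ltn_trans gap _; apply: si; lia.
    by apply: si; lia.
have t_max : t n.+1 = s n by rewrite /t; do !case: eqP; case: leqP => //=; lia.
have t_le j : (j <= n.+1)%N -> (t j <= m)%N.
  rewrite leq_eqVlt => /predU1P[->|jn]; first by rewrite t_max.
  by apply: leq_trans snm; rewrite -t_max ltnW // t_incr ?jn /=.
have t0 : t 0%N = s 0%N by [].
pose y j := x (t j).
have posP : 0 < PhiN omega (skip y 0).
  apply: (pos (fun j => t j.+1)) => [i j|i] ijn; first by apply: t_incr; lia.
  by apply: t_le; lia.
have posA : 0 < PhiN omega (skip y q.+1).
  apply: (pos (fun j => t (bump q.+1 j))) => [i j|i] ijn.
    by apply: t_incr; rewrite /bump; lia.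
  by apply: t_le; rewrite /bump; lia.
have posB : 0 < PhiN omega (skip (skip y 0) q).
  apply: (pos (fun j => t (bump 0 (bump q j)))) => [i j|i] ijn.
    by apply: t_incr; rewrite /bump; lia.
  by apply: t_le; rewrite /bump; lia.
have -> : PhiN (adjoin omega g) (fun j => x (s j)) =
          PhiN (adjoin omega g) (skip y q.+1).
  apply: eq_PhiN => j _; rewrite /skip /y /t /bump.
  case: (leqP q.+1 j) => jq /=; last by rewrite add0n -ltnS jq.
  by rewrite add1n; case: (leqP j.+1 q); [lia|case: eqP; [lia|]].
rewrite -(pmulr_rge0 _ posP) Phi_three_term ?gt_eqF //.
(* Dropping either end of [t] shrinks the spread. Since subtraction is truncated, the strict
   decrease also requires [s 0 < s n]. *)
have t_first : (t 0 < t 1)%N by rewrite t_incr.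
have t_last : (t n < t n.+1)%N by rewrite t_incr ?ltnSn /=.
have s0n : (s 0 < s n)%N by rewrite s_incr // leqnn (leq_trans _ qn).
rewrite addr_ge0 // mulr_ge0 ?(ltW posA) ?(ltW posB) //.
  apply: (IH (fun j => t j.+1)) => [|i j ij|]; first by lia.
    by apply: t_incr; lia.
  by rewrite t_max.
apply: (IH t) => [|i j ij|]; first by lia.
  by apply: t_incr; lia.
by apply: t_le; lia.
Qed.

Lemma min_family_le (R : realType) (k : nat) (a : 'I_k.+1 -> R) i :
  min_family a <= a i.
Proof. exact: bigmin_le. Qed.

Lemma le_max_family (R : realType) (k : nat) (a : 'I_k.+1 -> R) i :
  a i <= max_family a.
Proof. exact: le_bigmax. Qed.

Theorem corollary3 (R : realType) (n : nat) (hn : (0 < n)%N)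
  (H : set R) (hH : `I_n.+2 #<= H)
  (omega : 'I_n -> R -> R) (homega : positive_chebyshev H omega)
  (w : R -> R) (hstar : positive_chebyshev H (adjoin omega w))
  (m : nat) (hm : (0 < m)%N) (hnm : (n <= m)%N) (hmH : `I_m.+1 #<= H)
  (x : 'I_m.+1 -> R) (hx : sigma H x)
  (s : 'I_n.+1 -> 'I_m.+1)
  (hs : forall j k : 'I_n.+1, (j < k)%N -> (s j < s k)%N)
  (f : R -> R) :
  min_family (fun i : 'I_(m - n).+1 => gdivdiff omega w f (window x i))
    <= gdivdiff omega w f (fun j => x (s j))
    <= max_family (fun i : 'I_(m - n).+1 => gdivdiff omega w f (window x i)).
Proof.
(* Beyond [m], [inord] falls back to index 0, which still gives a point of [H]; hence [XH] needs no
   bound on [i]. *)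
pose X (i : nat) := x (inord i).
have XH i : H (X i) := hx.1 _.
have X_incr i j : (i < j <= m)%N -> X i < X j.
  by move=> ij; apply: hx.2; rewrite !inordK; lia.
have s_pos : 0 < Phi (adjoin omega w) (fun j => x (s j)).
  by apply: hstar.2; split=> [j|i j ij]; [apply: hx.1|apply: hx.2; apply: hs].
have win_pos (i : 'I_(m - n).+1) : 0 < Phi (adjoin omega w) (window x i).
  apply: hstar.2; split=> [j|j k jk]; first exact: XH.
  apply: X_incr; have := ltn_ord i; have := ltn_ord k; lia.
have ge0 g : (forall i : 'I_(m - n).+1,
      0 <= Phi (adjoin omega g) (window x i)) ->
    0 <= Phi (adjoin omega g) (fun j => x (s j)).
  move=> win; have -> : Phi (adjoin omega g) (fun j => x (s j)) =
      PhiN (adjoin omega g) (fun j => X (s (inord j))).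
    by apply: eq_Phi => j; rewrite /X !inord_val.
  apply: (PhiN_ge0_of_windows (m := m)) => [t t_incr t_le|i inm|i j ijn|].
  - apply: homega.2; split=> [j|i j ij]; first exact: XH.
    by apply: X_incr; rewrite t_le ?t_incr ?ij ?ltn_ord.
  - have im : (i < (m - n).+1)%N by lia.
    exact: (win (Ordinal im)).
  - by apply: hs; rewrite !inordK; lia.
  - exact: leq_ord.
set d := fun i : 'I_(m - n).+1 => _.
set lo := min_family d; set hi := max_family d.
have lo_le i : lo <= d i := min_family_le d i.
have le_hi i : d i <= hi := le_max_family d i.
rewrite {1}/gdivdiff ler_pdivlMr // {1}/gdivdiff ler_pdivrMr //.
apply/andP; split.
  (* For [f - lo * w], nonnegativity on a window says, after division by the positive denominator,
     that [lo <= d i]. The upper bound uses [hi * w - f] in the same way. *)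
  have := ge0 (fun t => 1 * f t + - lo * w t).
  rewrite Phi_adjoin_lincomb mul1r mulNr subr_ge0; apply => i.
  rewrite Phi_adjoin_lincomb mul1r mulNr subr_ge0 -ler_pdivlMr //.
  exact: lo_le.
have := ge0 (fun t => -1 * f t + hi * w t).
rewrite Phi_adjoin_lincomb mulN1r addrC subr_ge0; apply => i.
rewrite Phi_adjoin_lincomb mulN1r addrC subr_ge0 -ler_pdivrMr //.
exact: le_hi.
Qed.
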